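(* We have a sijection between signed sets $$[m]\times [n]\times S_{m,n,k} \leftrightarrow [m+n-2]^k + [n-1]\times [m-2]^k + [m-1]\times [n-2]^k + [m-1]\times [n-1]\times \alpha_k\times [2]^k.$$
   Context: Rook walks: $S_{m,n,k}$ is the set of walks of length $k$ a chess rook can move along on a rectangular board with width $m$ and height $n$, starting and ending on the bottom left square. Here a board of width $m$ and height $n$ has squares $\{0,\dots,m-1\}\times\{0,\dots,n-1\}$ (boards of width or height $1$ are allowed), with bottom left square $(0,0)$; a rook move goes from a square to a different square in the same row or the same column (any distance); and a walk of length $k$ is a sequence of squares $(p_0,\dots,p_k)$ in which each step from $p_{j-1}$ to $p_j$ is a rook move. Signed sets: a signed set is a finite set $S$ together with a weight function $w_S:S\to\{-1,1\}$. An ordinary finite set is regarded as a signed set with all weights equal to $1$. For signed sets $A,B$: $A+B$ is the disjoint union $A\sqcup B$ with weight $w_A$ on $A$ and $w_B$ on $B$; $A\times B$ is the Cartesian product with weight $w_{A\times B}((a,b))=w_A(a)w_B(b)$. $\alpha_i$ denotes the signed set containing a single element, of weight $(-1)^i$. A sijection $A\leftrightarrow B$ between signed sets is an involution $f$ on $A\sqcup B$ such that for every $x\in A\sqcup B$ the weight of $f(x)$ is $-w(x)$ if $x$ and $f(x)$ both lie in $A$ or both lie in $B$, and is $w(x)$ otherwise. Notation: $[r]=\{1,\dots,r\}$ for $r\ge 0$ (so $[0]=\emptyset$), and $[r]^k$ is the set of $k$-tuples with entries in $[r]$ (so $[r]^0$ has exactly one element, the empty tuple). In the boundary case $m=1$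 or $n=1$, where the symbol $[-1]^k$ occurs, it is read as the signed set $\alpha_k$, of total weight $(-1)^k$. *)

(* Defs.v *)
From mathcomp Require Import all_boot all_order all_algebra.
Set Implicit Arguments.
Unset Strict Implicit.
Unset Printing Implicit Defensive.
Import GRing.Theory.

Record signedSet := SignedSet {
  elts :> finType;
  wt : elts -> int;
  wtP : forall x, (wt x == 1%R) || (wt x == (-1)%R)
}.

Declare Scope signed_scope.
Delimit Scope signed_scope with SS.
Bind Scope signed_scope with signedSet.

Definition ordinary (T : finType) : signedSet :=
  @SignedSet T (fun=> 1%R) (fun=> isT).

Definition sum_wt (A B : signedSet) (x : A + B) : int :=
  match x with inl a => wt a | inr b => wt b end.

Lemma sum_wtP (A B : signedSet) (x : A + B) :
  (sum_wt x == 1%R) || (sum_wt x == (-1)%R).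
Proof. by case: x => [a | b] /=; apply: wtP. Qed.

Definition ssum (A B : signedSet) : signedSet :=
  @SignedSet (A + B)%type (@sum_wt A B) (@sum_wtP A B).

Definition prod_wt (A B : signedSet) (x : A * B) : int :=
  (wt x.1 * wt x.2)%R.

Lemma prod_wtP (A B : signedSet) (x : A * B) :
  (prod_wt x == 1%R) || (prod_wt x == (-1)%R).
Proof.
rewrite /prod_wt; case/orP: (wtP x.1) => /eqP ->;
  by case/orP: (wtP x.2) => /eqP ->.
Qed.

Definition sprod (A B : signedSet) : signedSet :=
  @SignedSet (A * B)%type (@prod_wt A B) (@prod_wtP A B).

Notation "A + B" := (ssum A B) : signed_scope.
Notation "A * B" := (sprod A B) : signed_scope.

Lemma sign_wtP (i : nat) (x : unit) :
  ((-1) ^+ i == 1 :> int)%R || ((-1) ^+ i == -1 :> int)%R.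
Proof. by rewrite -signr_odd; case: (odd i). Qed.

Definition alpha (i : nat) : signedSet :=
  @SignedSet unit (fun=> ((-1) ^+ i)%R) (sign_wtP i).

(* The set {1, ..., r} is encoded by 'I_r, that is, its labels are shifted to  *)
(* {0, ..., r - 1}.                                                            *)
Definition seg (r : nat) : signedSet := ordinary 'I_r.

(* [r]^k. The only negative r of interest is -1, for which [-1]^k is read as   *)
(* alpha k; the value for r < -1 is irrelevant.                                *)
Definition segX (r : int) (k : nat) : signedSet :=
  match r with
  | Posz r => ordinary (k.-tuple 'I_r)
  | Negz _ => alpha k
  end.

Definition same_side (A B : Type) (x y : A + B) : bool :=
  match x, y with
  | inl _, inl _ | inr _, inr _ => true
  | _, _ => false
  end.

Definition is_sijection (A B : signedSet) (f : (A + B)%SS -> (A + B)%SS) : Prop :=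
  involutive f /\
  forall x : (A + B)%SS,
    wt (f x) = if same_side x (f x) then (- wt x)%R else wt x.

Definition has_sijection (A B : signedSet) : Prop :=
  exists f : (A + B)%SS -> (A + B)%SS, is_sijection f.

Definition square (m n : nat) : finType := ('I_m * 'I_n)%type.

Definition bottom_left (m n : nat) (p : square m n) : bool :=
  (p.1 == 0 :> nat) && (p.2 == 0 :> nat).

Definition rook_move (m n : nat) : rel (square m n) :=
  fun p q => (p != q) && ((p.1 == q.1) || (p.2 == q.2)).

Definition closed_rook_walk (m n k : nat) (p : k.+1.-tuple (square m n)) : bool :=
  [&& bottom_left (tnth p ord0), bottom_left (tnth p ord_max)
    & path (@rook_move m n) (thead p) (behead p)].

Definition rook_walks (m n k : nat) : signedSet :=
  ordinary {p : k.+1.-tuple (square m n) | closed_rook_walk p}.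

(* Main.v *)
Require Import Defs.
From mathcomp Require Import all_boot all_order all_algebra.
From mathcomp Require Import ring zify.

(** The statement only asserts that some sijection exists, and a sijection
    between two signed sets exists as soon as their total weights agree
    ([has_sijection_of_total_wt]): reversing the sign on one side turns the
    defining condition into that of a sign-reversing involution on the disjoint
    union, and equally many positive and negative elements can be swapped in
    pairs.  What remains is the identity
      m n |S_(m,n,k)| = (m+n-2)^k + (n-1)(m-2)^k + (m-1)(n-2)^k
                        + (m-1)(n-1)(-2)^k.

    The rook graph is the Cartesian product of two complete graphs, so its
    adjacency operator is J_m (x) 1 + 1 (x) J_n - 2, where J is the all-ones
    operator: one step sums over the whole row and the whole column and removes
    the starting square, counted twice.  Write the indicator of the corner as
    the product of [x = 0] = (1 + u(x)) / m and [y = 0] = (1 + v(y)) / n, with u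
    and v of sum zero.  The adjacency operator then multiplies the functions 1,
    v, u and u v by m+n-2, m-2, n-2 and -2 respectively.  Hence the number of
    k-step walks from (x, y) to the corner, times m n, is
      (m+n-2)^k + v(y) (m-2)^k + u(x) (n-2)^k + u(x) v(y) (-2)^k
    ([rook_walk_count]), and at the corner u = m-1 and v = n-1. *)

Set Implicit Arguments.
Unset Strict Implicit.
Unset Printing Implicit Defensive.
Import GRing.Theory.
Local Open Scope ring_scope.

(** * Sijections from total weights *)

(** The involution matches the i-th element of the set with the i-th element of
    its complement. *)
Lemma swap_complement (T : finType) (P : {set T}) :
  #|P| = #|~: P| ->
  exists2 f : T -> T, involutive f & forall x, (f x \in P) = (x \notin P).
Proof.
move=> cardP.
pose g (A : {set T}) x := nth x (enum (~: A)) (index x (enum A)).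
have g_in (A : {set T}) x : #|A| = #|~: A| -> x \in A -> g A x \notin A.
  move=> cA xA; rewrite -in_setC -mem_enum mem_nth //.
  by rewrite -cardE -cA cardE index_mem mem_enum.
have gK (A : {set T}) x :
    #|A| = #|~: A| -> x \in A -> g (~: A) (g A x) = x.
  move=> cA xA; rewrite /g setCK index_uniq ?enum_uniq //; last first.
    by rewrite -cardE -cA cardE index_mem mem_enum.
  (* The default values of [nth] differ, but the index is within bounds. *)
  rewrite (set_nth_default x) ?nth_index ?mem_enum //.
  by rewrite index_mem mem_enum.
have cardC : #|~: P| = #|~: ~: P| by rewrite setCK.
exists (fun x => if x \in P then g P x else g (~: P) x) => x.
  case: (boolP (x \in P)) => xP.
    by rewrite (negbTE (g_in _ _ cardP xP)) gK.
  have xC : x \in ~: P by rewrite inE.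
  have := g_in _ _ cardC xC; rewrite inE negbK => ->.
  by have := gK _ _ cardC xC; rewrite setCK.
case: (boolP (x \in P)) => xP; first by rewrite (negbTE (g_in _ _ cardP xP)).
by have := g_in (~: P) x cardC; rewrite !inE xP negbK => ->.
Qed.

Definition total_wt (A : signedSet) : int := \sum_(x : A) wt x.

Lemma sum_sign (T : finType) (P : {set T}) (s : T -> int) :
  (forall x, s x = if x \in P then 1 else -1) ->
  \sum_x s x = #|P|%:Z - #|~: P|%:Z.
Proof.
move=> sE; rewrite (bigID (mem P)) /=; congr (_ + _).
  rewrite (eq_bigr (fun=> 1)) => [|x xP]; last by rewrite sE xP.
  by rewrite sumr_const natz.
rewrite (eq_bigr (fun=> -1)) => [|x xP]; last by rewrite sE (negbTE xP).
rewrite sumr_const mulNrn natz; congr (- (Posz _)).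
by apply: eq_card => x; rewrite !inE.
Qed.

Lemma has_sijection_of_total_wt (A B : signedSet) :
  total_wt A = total_wt B -> has_sijection A B.
Proof.
move=> eqAB.
(* Weights are negated on [B], so a sijection reverses [s] everywhere. *)
pose s (x : A + B) : int :=
  match x with inl a => wt a | inr b => - wt b end.
pose P := [set x | s x == 1].
have sE x : s x = if x \in P then 1 else -1.
  rewrite inE; case: x => [a|b] /=.
    by case/orP: (wtP a) => /eqP ->.
  by case/orP: (wtP b) => /eqP ->.
have cardP : #|P| = #|~: P|.
  suff /eqP: \sum_x s x = 0 by rewrite (sum_sign sE) subr_eq0 => /eqP[].
  by rewrite big_sumType /= sumrN; apply/eqP; rewrite subr_eq0; apply/eqP.
have [f fK fP] := swap_complement cardP.
have sf x : s (f x) = - s x.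
  by rewrite !sE fP; case: (x \in P); rewrite //= opprK.
exists f; split=> // x; move: (sf x).
case: x => [a|b]; case: (f _) => [a'|b'] //= e.
- exact: oppr_inj.
- by rewrite e opprK.
- exact: oppr_inj.
Qed.

Lemma total_wt_sum (A B : signedSet) :
  total_wt (A + B)%SS = total_wt A + total_wt B.
Proof. by rewrite /total_wt big_sumType. Qed.

Lemma total_wt_prod (A B : signedSet) :
  total_wt (A * B)%SS = total_wt A * total_wt B.
Proof. by rewrite /total_wt big_distrlr pair_bigA. Qed.

Lemma total_wt_ordinary (T : finType) : total_wt (ordinary T) = #|T|%:Z.
Proof. by rewrite /total_wt sumr_const natz; congr (Posz _); apply: eq_card. Qed.

Lemma total_wt_seg r : total_wt (seg r) = r%:Z.
Proof. by rewrite total_wt_ordinary card_ord. Qed.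

Lemma total_wt_alpha k : total_wt (alpha k) = (-1) ^+ k.
Proof. by rewrite /total_wt big_const card_unit /= addr0. Qed.

Lemma total_wt_segX (r : int) k : -1 <= r -> total_wt (segX r k) = r ^+ k.
Proof.
case: r => [r|[|r]] // _; last exact: total_wt_alpha.
by rewrite /= total_wt_ordinary card_tuple card_ord -!natz natrX.
Qed.

(** * Walks with a fixed starting point *)

Lemma sum_tuple_cons (R : nmodType) (T : finType) k (F : k.+1.-tuple T -> R) :
  \sum_t F t = \sum_x \sum_(t : k.-tuple T) F [tuple of x :: t].
Proof.
rewrite pair_bigA /=.
rewrite (reindex (fun p : T * k.-tuple T => [tuple of p.1 :: p.2])) //=.
exists (fun t : k.+1.-tuple T => (thead t, [tuple of behead t])).
  by case=> x t _ /=; rewrite theadE; congr (_, _); apply: val_inj.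
by move=> t _ /=; rewrite -tuple_eta.
Qed.

Section Walks.
Variables (T : finType) (e : rel T) (P : pred T).

Definition walk_count k x : int :=
  \sum_(t : k.-tuple T) (path e x t && P (last x t))%:R.

Lemma walk_count0 x : walk_count 0 x = (P x)%:R.
Proof.
rewrite /walk_count (eq_bigr (fun=> (P x)%:R)) => [|t _]; last by rewrite tuple0.
by rewrite sumr_const card_tuple expn0.
Qed.

Lemma walk_countS k x :
  walk_count k.+1 x = \sum_(y | e x y) walk_count k y.
Proof.
rewrite /walk_count sum_tuple_cons [RHS]big_mkcond; apply: eq_bigr => y _ /=.
by case: (e x y) => //=; rewrite big1.
Qed.

End Walks.

(** * Walks on the rook graph *)

(** A rook reaches the rest of its row and the rest of its column, whereas the
    full row and the full column each contain the starting square. *)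
Lemma sum_rook_move m n (F : square m n -> int) (x : 'I_m) (y : 'I_n) :
  \sum_(q | rook_move (x, y) q) F q =
    \sum_x' F (x', y) + \sum_y' F (x, y') - F (x, y) *+ 2.
Proof.
have -> : \sum_(q | rook_move (x, y) q) F q =
    \sum_(x' | x' != x) F (x', y) + \sum_(y' | y' != y) F (x, y').
  rewrite (bigID (fun q : square m n => q.2 == y)) /=; congr (_ + _).
    rewrite (reindex_onto (fun x' => (x', y)) fst) /=.
      apply: eq_bigl => x'; rewrite /rook_move /= !eqxx orbT !andbT xpair_eqE eqxx.
      by rewrite andbT eq_sym.
    by case=> x' y' /andP[_ /eqP /= ->].
  rewrite (reindex_onto (fun y' => (x, y')) snd) /=.
    apply: eq_bigl => y'; rewrite /rook_move /= !eqxx andbT xpair_eqE eqxx /=.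
    by rewrite eq_sym; case: eqP; rewrite ?andbT.
  case=> x' y' /andP[/andP[_ /=]]; rewrite eq_sym [in X in _ || X]eq_sym.
  by case: (y' == y); rewrite ?orbF // => /eqP ->.
rewrite [in RHS](bigD1 x) // [in RHS](bigD1 (F := fun y' => F (x, y')) y) //=.
ring.
Qed.

(** The component of m [i = 0] orthogonal to the constants, which the adjacency
    operator of the complete graph on m vertices multiplies by -1. *)
Definition centred_corner m (i : 'I_m) : int := m%:Z * (i == 0 :> nat)%:R - 1.

Lemma sum_centred_corner m : (0 < m)%N -> \sum_i @centred_corner m i = 0.
Proof.
move=> hm; rewrite sumrB sumr_const card_ord natz -mulr_sumr.
rewrite (bigD1 (Ordinal hm)) //= big1 => [|i]; first by rewrite addr0 mulr1 subrr.
by rewrite -val_eqE /= => /negbTE ->.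
Qed.

(** At k = 0 the right-hand side factors as (1 + u) (1 + v), which is m n times
    the indicator of the corner.  One step multiplies each of the four terms by
    its base: in the sum over the row u vanishes, in the sum over the column v
    vanishes, and a function constant in the summed coordinate gains the factor
    m or n. *)
Lemma rook_walk_count m n k (x : 'I_m) (y : 'I_n) : (0 < m)%N -> (0 < n)%N ->
  let u := centred_corner x in let v := centred_corner y in
  m%:Z * n%:Z * walk_count (@rook_move m n) (@bottom_left m n) k (x, y) =
    (m%:Z + n%:Z - 2) ^+ k + v * (m%:Z - 2) ^+ k
    + u * (n%:Z - 2) ^+ k + u * v * (-2) ^+ k.
Proof.
move=> hm hn /=; elim: k x y => [|k IHk] x y.
  rewrite walk_count0 /centred_corner /bottom_left -mulnb natrM !expr0 /=.
  ring.
rewrite walk_countS sum_rook_move mulrBr mulrDr mulrnAr IHk !mulr_sumr.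
under eq_bigr => x' _ do rewrite IHk.
under [X in _ + X - _]eq_bigr => y' _ do rewrite IHk.
rewrite !big_split /= -!mulr_suml -!mulr_sumr !sum_centred_corner //.
have sum_cst p (c : int) : \sum_(i < p) c = p%:Z * c.
  by rewrite sumr_const card_ord -mulr_natl natz.
rewrite !sum_cst !exprS.
ring.
Qed.

(** A closed walk is recorded with its first square, which has to be the corner;
    deleting that square leaves the k-tuple counted by [walk_count]. *)
Lemma total_wt_rook_walks m n k (hm : (0 < m)%N) (hn : (0 < n)%N) :
  total_wt (rook_walks m n k) =
  walk_count (@rook_move m n) (@bottom_left m n) k (Ordinal hm, Ordinal hn).
Proof.
rewrite total_wt_ordinary card_sig -natz -sum1_card natr_sum big_mkcond /=.
rewrite sum_tuple_cons (bigD1 (Ordinal hm, Ordinal hn)) //=.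
rewrite [X in _ + X]big1 ?addr0 => [|p p_neq].
  apply: eq_bigr => t _; rewrite inE /closed_rook_walk theadE tnth0.
  rewrite (tnth_nth (Ordinal hm, Ordinal hn)) /= andbC.
  by rewrite -[X in nth _ _ X](size_tuple t) -last_nth; case: ifP.
apply: big1 => t _; rewrite inE /closed_rook_walk tnth0 /=.
case: ifP => // /and3P[/andP[/eqP p1 /eqP p2] _ _].
by case/eqP: p_neq; case: p p1 p2 => a b /= p1 p2; congr (_, _); apply: val_inj.
Qed.

Local Close Scope ring_scope.

Theorem theorem1p12 (m n k : nat) (hm : 0 < m) (hn : 0 < n) :
  has_sijection
    (seg m * seg n * rook_walks m n k)%SS
    (segX (m%:Z + n%:Z - 2)%R k
     + seg (n - 1) * segX (m%:Z - 2)%R k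
     + seg (m - 1) * segX (n%:Z - 2)%R k
     + seg (m - 1) * seg (n - 1) * alpha k * segX 2 k)%SS.
Proof.
apply: has_sijection_of_total_wt.
rewrite !(total_wt_sum, total_wt_prod) !total_wt_seg total_wt_alpha.
(* Positivity of m and n keeps every base at least -1, the smallest for which
   [segX] has weight a power of its base. *)
rewrite !total_wt_segX; try lia.
rewrite (total_wt_rook_walks k hm hn) rook_walk_count // /centred_corner /=.
rewrite !mulr1 -!subzn // -[(-2)%R]mulN1r exprMn.
ring.
Qed.
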